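(* Let $G$ be a connected graph and let $s,t\in V(G)$. Then $d_G(s,t)=1$ if and only if $\lambda_G(s,t)=1$.
   Context: Rendezvous game with adversaries. Let $G$ be a finite, simple, undirected, connected graph, let $s,t\in V(G)$ and let $k\ge 1$ be an integer. Two players play: Facilitator, who controls two agents $R$ and $J$ initially placed on $s$ and $t$ respectively, and Divider, who controls $k$ agents $D_1,\dots,D_k$ which Divider initially places on vertices of $V(G)\setminus\{s,t\}$ of his choice (several agents may share a vertex). After the initial placement the players alternate moves, Facilitator moving first. In a move, the player moves each of his agents to an adjacent vertex or leaves it where it is; no agent may be moved to a vertex currently occupied by an agent of the opponent. Both players have full information. Facilitator wins if at some moment $R$ and $J$ occupy the same vertex; Divider wins if this never happens. $d_G(s,t)$ (the $(s,t)$-dividing number) is the minimum $k$ such that Divider with $k$ agents has a winning strategy on $G$ against Facilitator starting from $s$ and $t$; $d_G(s,t)=+\infty$ if $s=t$ or $s,t$ are adjacent. $\lambda_G(s,t)$ is the minimum size of a set $S\subseteq V(G)\setminus\{s,t\}$ such that $s$ and $t$ lie in different connected components of $G-S$; $\lambda_G(s,t)=+\infty$ if $s=t$ or $s,t$ are adjacent. *)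

(* Defs.v *)
From mathcomp Require Import all_boot.
Set Implicit Arguments. Unset Strict Implicit. Unset Printing Implicit Defensive.

Section Game.
Variables (T : finType) (e : rel T).

Definition simple_graph := symmetric e /\ irreflexive e.
Definition connected_graph := forall x y : T, connect e x y.

Definition step (x y : T) : bool := (x == y) || e x y.

Definition dconf (k : nat) := {ffun 'I_k -> T}.

Definition occupied k (D : dconf k) (v : T) : bool := [exists i, D i == v].

(* Facilitator's legal move from (R,J) to (R',J') while Divider agents are at D *)
Definition fmove k (D : dconf k) (p p' : T * T) : bool :=
  [&& step p.1 p'.1, step p.2 p'.2, ~~ occupied D p'.1 & ~~ occupied D p'.2].

Definition dmove k (p : T * T) (D D' : dconf k) : bool :=
  [forall i, [&& step (D i) (D' i), D' i != p.1 & D' i != p.2]].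

(* Divider's positions along a play: D0 is the initial placement; after Facilitator's
   (n+1)-th move, Divider answers with sigma applied to the full history of
   Facilitator positions f 1, ..., f (n+1). *)
Definition dpos k (D0 : dconf k) (sigma : seq (T * T) -> dconf k)
  (f : nat -> T * T) (n : nat) : dconf k :=
  if n is n'.+1 then sigma (mkseq (fun i => f i.+1) n'.+1) else D0.

(* Divider with k agents has a winning strategy from s, t: an initial placement
   off {s,t} and a (full-information, history-dependent) strategy such that for every
   sequence of Facilitator positions f starting at (s,t), as long as Facilitator's moves
   are legal, R and J never coincide and Divider's answers are legal. *)
Definition divider_wins (k : nat) (s t : T) : Prop :=
  s != t /\
  exists (D0 : dconf k) (sigma : seq (T * T) -> dconf k),
    (forall i, D0 i != s /\ D0 i != t) /\
    forall f : nat -> T * T, f 0 = (s, t) ->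
      forall n, (forall m, m <= n -> fmove (dpos D0 sigma f m) (f m) (f m.+1)) ->
        (f n.+1).1 != (f n.+1).2 /\
        dmove (f n.+1) (dpos D0 sigma f n) (dpos D0 sigma f n.+1).

Definition dividing_number_is (s t : T) (k : nat) : Prop :=
  [/\ s != t, ~~ e s t, 0 < k, divider_wins k s t &
      forall k', 0 < k' < k -> ~ divider_wins k' s t].

Definition separates (S : {set T}) (s t : T) : bool :=
  [&& s \notin S, t \notin S &
      ~~ connect [rel x y | [&& e x y, x \notin S & y \notin S]] s t].

Definition cut_number_is (s t : T) (k : nat) : Prop :=
  [/\ s != t, ~~ e s t,
      exists S : {set T}, #|S| = k /\ separates S s t &
      forall S : {set T}, #|S| < k -> ~~ separates S s t].

End Game.

(* Main.v *)
(** If a cut vertex exists, Divider just stays on it.  Conversely, if no vertex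
separates [s] from [t], then [s] and [t] lie on a common (possibly degenerate)
cycle, and Facilitator beats a single agent from any two vertices of a cycle, by
induction on the length [n] of the cycle.
If the cycle is isometric, both agents run towards each other along one arc; if
Divider's agent ever enters this arc, it stands on the cycle, the complementary
arc is free, and by isometry it is too slow to get there before they meet.
Otherwise take a shortest shortcut between two vertices [u], [v] of the cycle.
If [R] and [J] lie on the same side of the shortcut, rerouting the other side
gives a shorter cycle through both.  If not, [R] heads for [u] while [J] heads for
[v] along disjoint arcs: one agent cannot block both, and as soon as one of them
arrives the previous case applies. *)

Require Import Defs.
From mathcomp Require Import all_boot.
From mathcomp Require Import zify.

Set Implicit Arguments. Unset Strict Implicit. Unset Printing Implicit Defensive.

Section Rendezvous.
Variables (T : finType) (e : rel T).
Hypothesis e_sym : symmetric e.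

(** * Facilitator's game against a single agent *)

Lemma step_refl x : step e x x.
Proof. by rewrite /step eqxx. Qed.

Lemma step_sym x y : step e x y = step e y x.
Proof. by rewrite /step eq_sym e_sym. Qed.

(* Positions of [R], [J] and the only Divider agent, with Facilitator to move. *)
Inductive win : T -> T -> T -> Prop :=
| WinMeet r j d x : step e r x -> step e j x -> x != d -> win r j d
| WinMove r j d r' j' : step e r r' -> step e j j' -> r' != d -> j' != d ->
    (forall d', step e d d' -> d' != r' -> d' != j' -> win r' j' d') ->
    win r j d.

Lemma eq_dpos k D0 sigma (f g : nat -> T * T) n :
  (forall i, i <= n -> f i = g i) ->
  dpos (k := k) D0 sigma f n = dpos D0 sigma g n.
Proof.
case: n => [//|n] fg /=; congr sigma.
by apply/eq_in_map => i; rewrite mem_iota => /andP[_ i_lt]; apply: fg; lia.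
Qed.

Lemma occupied1 (D : dconf T 1) v : occupied D v = (D ord0 == v).
Proof.
by apply/existsP/idP => [[i]|Dv]; [rewrite (ord1 i) | exists ord0].
Qed.

(** Induction on [win] against a fixed [sigma]: a finite legal play is prolonged by Facilitator's
    winning move, and the legality of Divider's answer is what the induction hypothesis asks for. *)
Lemma win_not_divider_wins s t :
  (forall d, d != s -> d != t -> win s t d) -> ~ divider_wins e 1 s t.
Proof.
move=> w_st [_ [D0 [sigma [D0P sigmaP]]]].
have [D0s D0t] := D0P ord0.
suff lose r j d : win r j d -> forall n f, f 0 = (s, t) ->
    (forall m, m < n -> fmove e (dpos D0 sigma f m) (f m) (f m.+1)) ->
    f n = (r, j) -> dpos D0 sigma f n ord0 = d -> False.
  exact: (lose _ _ _ (w_st _ D0s D0t) 0 (fun=> (s, t))).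
(* Plays are infinite sequences, so the prolonged play is constantly [p] after index [n]; Divider's
   positions up to [n] depend only on the unchanged entries. *)
have extend n f p : f 0 = (s, t) ->
    (forall m, m < n -> fmove e (dpos D0 sigma f m) (f m) (f m.+1)) ->
    fmove e (dpos D0 sigma f n) (f n) p ->
    exists f', [/\ f' 0 = (s, t), f' n.+1 = p,
      dpos D0 sigma f' n = dpos D0 sigma f n &
      forall m, m <= n -> fmove e (dpos D0 sigma f' m) (f' m) (f' m.+1)].
  move=> f0 fP fp; pose f' i := if i <= n then f i else p.
  have ff' m : m <= n -> dpos D0 sigma f' m = dpos D0 sigma f m.
    by move=> m_le; apply: eq_dpos => i i_le; rewrite /f' ifT //; lia.
  exists f'; split; rewrite ?ff' //; first by rewrite /f' ltnn.
  move=> m m_le; rewrite ff' // /f' m_le; case: ltnP => m_n; first exact: fP.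
  by have -> : m = n by lia.
elim=> {r j d} [r j d x rx jx xd|r j d r' j' rr' jj' r'd j'd _ IH] n f f0 fP fn Dn.
  have [|f' [f'0 f'n _ f'P]] := extend n f (x, x) f0 fP.
    by rewrite /fmove fn !occupied1 Dn /= rx jx eq_sym xd.
  by have [] := sigmaP f' f'0 n f'P; rewrite f'n eqxx.
have [|f' [f'0 f'n dn f'P]] := extend n f (r', j') f0 fP.
  by rewrite /fmove fn !occupied1 Dn /= rr' jj' eq_sym r'd eq_sym j'd.
have [_ /forallP/(_ ord0)] := sigmaP f' f'0 n f'P.
rewrite dn Dn f'n => /and3P[d1 d2 d3].
exact: (IH _ d1 d2 d3 n.+1 f').
Qed.

(** * Walks and cycles *)

Definition walk (f : nat -> T) n := forall i, i < n -> step e (f i) (f i.+1).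
Definition inj_upto (f : nat -> T) n := forall i j, i < j -> j < n -> f i <> f j.
(** Length 2 is allowed: an edge traversed back and forth is a degenerate cycle. *)
Definition cycle_of (c : nat -> T) n :=
  [/\ c n = c 0, walk c n & inj_upto c n].

Lemma cycle_rev c n : cycle_of c n -> cycle_of (fun i => c (n - i)) n.
Proof.
move=> [cn cw ci]; split; first by rewrite subnn subn0.
  move=> i i_n; rewrite step_sym.
  have -> : n - i = (n - i.+1).+1 by lia.
  by apply: cw; lia.
move=> [|i] j ij jn; last by apply/nesym/ci; lia.
by rewrite subn0 cn; apply: ci; lia.
Qed.

Lemma cycle_rot c n d : d < n -> cycle_of c n ->
  cycle_of (fun i => if i + d < n then c (i + d) else c (i + d - n)) n.
Proof.
move=> dn [cn cw ci]; split.
- by rewrite add0n dn ifF; [congr c; lia | lia].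
- move=> i i_n; case: ifP => lt1; case: ifP => lt2; try lia.
  + by apply: cw; lia.
  + have -> : i.+1 + d - n = 0 by lia.
    rewrite -cn.
    have -> : n = (i + d).+1 by lia.
    by apply: cw; lia.
  + have -> : i.+1 + d - n = (i + d - n).+1 by lia.
    by apply: cw; lia.
move=> i j ij jn; case: ifP => lt1; case: ifP => lt2; try lia.
- by apply: ci; lia.
- by apply/nesym/ci; lia.
- by apply: ci; lia.
Qed.

Lemma cycle_rot_index c n d a : d < n -> cycle_of c n -> a <= n ->
  exists2 i, i <= n & (if i + d < n then c (i + d) else c (i + d - n)) = c a.
Proof.
move=> dn [cn _ _] an; case: (leqP d a) => da.
  exists (a - d); first lia.
  have -> : a - d + d = a by lia.
  by case: ltnP => // na; have -> : a = n; [lia | rewrite subnn].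
by exists (a + n - d); [lia | rewrite ifF; [congr c; lia | lia]].
Qed.

(* Replaces the arc [0, k] of the cycle [c] by the walk [f]. *)
Lemma splice c n k f q : cycle_of c n -> k < n -> 0 < k ->
  f 0 = c 0 -> f q = c k -> walk f q -> inj_upto f q.+1 ->
  (forall t i, 0 < t < q -> i <= n -> f t <> c i) ->
  exists c', [/\ cycle_of c' (q + (n - k)), forall t, t <= q -> c' t = f t &
    forall a, k <= a <= n -> c' (q + (a - k)) = c a].
Proof.
move=> [cn cw ci] kn k0 f0 fq fw fi fc.
pose c' i := if i <= q then f i else c (i - q + k).
have c'l t : t <= q -> c' t = f t by rewrite /c' => ->.
have c'r a : k <= a <= n -> c' (q + (a - k)) = c a.
  move=> ak; rewrite /c'; case: leqP => qa; last by congr c; lia.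
  have -> : a = k by lia.
  by rewrite subnn addn0.
exists c'; split=> //; split.
- by rewrite c'r ?c'l ?cn ?f0 //; lia.
- move=> i i_n; case: (ltnP i q) => iq.
    by rewrite !c'l; [exact: fw | lia | lia].
  have -> : i.+1 = q + ((i - q + k).+1 - k) by lia.
  have -> : i = q + ((i - q + k) - k) by lia.
  rewrite [X in step _ X]c'r; last lia.
  have -> : (q + (i - q + k - k) - q + k) = i - q + k by lia.
  by rewrite c'r; [apply: cw; lia | lia].
move=> i j ij jn; case: (leqP j q) => jq.
  by rewrite !c'l; [apply: fi; lia | lia | lia].
have -> : j = q + ((j - q + k) - k) by lia.
rewrite [X in _ <> X]c'r; last lia.
case: (ltngtP i q) => iq.
- rewrite c'l; last lia.
  case: (posnP i) => [->|i0]; first by rewrite f0; apply: ci; lia.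
  by apply: fc; lia.
- have -> : i = q + ((i - q + k) - k) by lia.
  by rewrite c'r; [apply: ci; lia | lia].
by rewrite iq c'l // fq; apply: ci; lia.
Qed.

(** * Cycles through two vertices that no vertex separates *)

Lemma connect_walk (r : rel T) x y : connect r x y ->
  exists f m, [/\ f 0 = x, f m = y, forall i, i < m -> r (f i) (f i.+1) &
    inj_upto f m.+1].
Proof.
case/connectP=> p0 p0P ->; case/shortenP: p0P => p pP p_uniq _.
exists (nth x (x :: p)), (size p); split=> //.
- by rewrite (last_nth x).
- by move=> i i_p; move/(pathP x): pP => /(_ _ i_p).
by move=> i j ij jp /eqP; rewrite (@nth_uniq _ x (x :: p)) ?(ltn_trans ij jp) ?ltn_eqF.
Qed.

(** The singleton [[set v]] is kept so that this is the relation inside [separates] for that set. *)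
Definition avoid v : rel T :=
  [rel x y | [&& e x y, x \notin [set v] & y \notin [set v]]].

Lemma avoid_connect_sym v : connect_sym (avoid v).
Proof.
apply: sym_connect_sym => x y.
by rewrite /avoid /= e_sym; case: (e y x) => //=; rewrite andbC.
Qed.

(* Whitney's induction along an [s]-[t] path: a cycle through [s] and a vertex [x i]
   of the path is spliced with a walk back from [x i.+1] that avoids [x i]. For
   [i = 0] the walk [x 0, x 1, x 0] serves as a degenerate cycle of length 2. *)
Lemma cycle_through s t : s != t -> connect e s t ->
  (forall v, v != s -> v != t -> connect (avoid v) s t) ->
  exists c n a b, [/\ cycle_of c n, a <= n, b <= n, c a = s & c b = t].
Proof.
move=> st /connect_walk[x [k [x0 xk xe xi]]] nsep.
have k0 : 0 < k by case: k xk {xe xi} => // x0'; rewrite -x0 x0' eqxx in st.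
suff H i : i < k ->
    exists c n a b, [/\ cycle_of c n, a <= n, b <= n, c a = s & c b = x i.+1].
  by have [|] := H k.-1; [lia | rewrite prednK // xk => c ?; exists c].
elim: i => [_|i IH ik].
  exists (fun i => if i == 1 then x 1 else x 0), 2, 0, 1; split=> //.
  have s01 : step e (x 0) (x 1) by rewrite /step xe ?orbT.
  split=> // [[|[|]] //= _|]; first by rewrite step_sym.
  by move=> [|i] [|[|j]] //= _ _; apply: xi; lia.
have [c0 [n [a0 [b0 [c0P a0n b0n c0a c0b]]]]] := IH (ltnW ik).
have xNs j : 0 < j <= k -> x j != s.
  by move=> jk; rewrite -x0 eq_sym; apply/eqP/xi; lia.
have [c [a [cP an ca c_0]]] :
    exists c a, [/\ cycle_of c n, a <= n, c a = s & c 0 = x i.+1].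
  have [b0_n|b0_n] := ltnP b0 n; last first.
    exists c0, a0; split=> //; case: c0P => cn _ _.
    by rewrite -cn -c0b; congr c0; lia.
  have [a an ca] := cycle_rot_index b0_n c0P a0n.
  exists (fun i => if i + b0 < n then c0 (i + b0) else c0 (i + b0 - n)), a.
  by split=> //; [exact: cycle_rot | rewrite ca | rewrite add0n b0_n].
pose on_c y := [exists b : 'I_n.+1, c b == y].
have on_cP y : reflect (exists2 b, b <= n & c b = y) (on_c y).
  apply: (iffP existsP) => [[b /eqP cb]|[b bn cb]].
    by exists b; rewrite // -ltnS.
  by exists (Ordinal (bn : b < n.+1)); apply/eqP.
have [/on_cP[b bn cb]|y_c] := boolP (on_c (x i.+2)).
  by exists c, n, a, b.
(* From [x i.+2] the path leads to [t] off [x i.+1], and non-separation leads from [t] on to [s]. *)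
have [g [m [g0 gm gr gi]]] : exists g m, [/\ g 0 = x i.+2, g m = s,
    forall j, j < m -> avoid (x i.+1) (g j) (g j.+1) & inj_upto g m.+1].
  apply: connect_walk; rewrite avoid_connect_sym.
  have tail j : i.+2 + j <= k -> connect (avoid (x i.+1)) (x i.+2) (x (i.+2 + j)).
    elim: j => [|j IHj] jk; first by rewrite addn0.
    apply: connect_trans (IHj _) (connect1 _); first lia.
    rewrite addnS /avoid /= xe ?inE; last lia.
    by rewrite /=; apply/andP; split; rewrite eq_sym; apply/eqP/xi; lia.
  apply: connect_trans (nsep (x i.+1) _ _) _; first by apply: xNs; lia.
    by rewrite -xk; apply/eqP/xi; lia.
  by rewrite avoid_connect_sym -xk; have := tail (k - i.+2); rewrite subnKC //; apply.
have gN j : j <= m -> g j <> x i.+1.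
  rewrite leq_eqVlt => /orP[/eqP->|/gr/and3P[_ + _]]; last by rewrite inE => /eqP.
  by rewrite gm; apply/nesym/eqP/xNs; lia.
have exl : exists l, on_c (g l) by exists m; apply/on_cP; exists a; rewrite ?gm.
(* [l] is the first time at which [g] meets the cycle, so [f] below is a chord from [c 0] to [c b]
   with no inner vertex on the cycle. *)
case: (ex_minnP exl) => l /on_cP[b bn cb] lmin.
have lm : l <= m by apply: lmin; apply/on_cP; exists a; rewrite ?gm.
have l0 : 0 < l by case: l cb {lmin lm} => // cb; case/on_cP: y_c; exists b; rewrite ?cb.
have cn : c n = c 0 by case: cP.
have b_gt0 : 0 < b.
  by case: (posnP b) => // b_0; case: (gN l lm); rewrite -cb b_0 c_0.
have b_n : b < n.
  by rewrite ltn_neqAle bn andbT; apply/eqP => b_n; case: (gN l lm); rewrite -cb b_n cn c_0.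
pose f j := if j is j'.+1 then g j' else x i.+1.
have fw : walk f l.+1.
  move=> [_|j jl] /=; first by rewrite g0 /step xe ?orbT.
  by rewrite /step; have /and3P[-> _ _] := gr j ltac:(lia); rewrite orbT.
have fi : inj_upto f l.+2.
  move=> [|u] [|v] //= uv vl; first by apply/nesym/gN; lia.
  by apply: gi; lia.
have fc u v : 0 < u < l.+1 -> v <= n -> f u <> c v.
  case: u => // u /= ul vn guv.
  suff /lmin : on_c (g u) by lia.
  by apply/on_cP; exists v.
(* The new cycle keeps the arc containing [s]: either [[b, n]], or [[0, b]] after a reversal. The
   vertex [x i.+2] has index 1 on it. *)
have [ab|ba] := leqP b a.
  have [c' [c'P c'l c'r]] := splice (q := l.+1) cP b_n b_gt0 (esym c_0) (esym cb) fw fi fc.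
  exists c', (l.+1 + (n - b)), (l.+1 + (a - b)), 1; split=> //; try lia.
    by rewrite c'r //; lia.
  by rewrite c'l.
have [|||||c' [c'P c'l c'r]] :=
    splice (k := n - b) (f := f) (q := l.+1) (cycle_rev cP) _ _ _ _ fw fi.
- lia.
- lia.
- by rewrite subn0 cn.
- by rewrite subKn.
- by move=> u v ul vn; apply: fc => //; lia.
exists c', (l.+1 + (n - (n - b))), (l.+1 + ((n - a) - (n - b))), 1; split=> //; try lia.
  by rewrite c'r ?subKn //; lia.
by rewrite c'l.
Qed.

(** * Distances *)

(** Since [step] permits waiting, this means distance at most [q]. *)
Fixpoint reach q x y : bool :=
  if q is q'.+1 then [exists z, step e x z && reach q' z y] else x == y.

Lemma reachP q x y :
  reflect (exists f, [/\ f 0 = x, f q = y & walk f q]) (reach q x y).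
Proof.
elim: q x => [|q IH] x /=.
  by apply: (iffP eqP) => [->|[f [<- <- _]]//]; exists (fun=> y).
apply: (iffP existsP) => [[z /andP[xz /IH[f [f0 fq fw]]]]|[f [f0 fq fw]]].
  exists (fun i => if i is i'.+1 then f i' else x); split=> //.
  by move=> [|i] i_q; [rewrite f0 | apply: fw].
exists (f 1); rewrite -f0 fw //=; apply/IH; exists (fun i => f i.+1).
by split=> // i i_q; apply: fw.
Qed.

Lemma walk_reach f n i j : walk f n -> i <= j <= n -> reach (j - i) (f i) (f j).
Proof.
move=> fw ij; apply/reachP; exists (fun k => f (k + i)).
by split=> [||k k_lt]; [|congr f; lia|apply: fw; lia].
Qed.

Lemma reach_cat p q x y z : reach p x y -> reach q y z -> reach (p + q) x z.
Proof.
elim: p x => [|p IH] x /=; first by move/eqP->.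
case/existsP=> w /andP[xw wy] yz; apply/existsP; exists w.
by rewrite xw IH.
Qed.

Lemma reach1 x y : reach 1 x y = step e x y.
Proof.
apply/existsP/idP => [[z /andP[xz /eqP<-]]//|xy].
by exists y; rewrite xy eqxx.
Qed.

Lemma reach_sym q x y : reach q x y = reach q y x.
Proof.
suff H x' y' : reach q x' y' -> reach q y' x' by apply/idP/idP; apply: H.
case/reachP=> f [<- <- fw]; apply/reachP; exists (fun i => f (q - i)).
split; [by rewrite subn0 | by rewrite subnn |].
move=> i i_q; rewrite step_sym; have -> : q - i = (q - i.+1).+1 by lia.
by apply: fw; lia.
Qed.

(** * Meeting on an isometric cycle *)

(** Along a free arc both agents step inwards; they meet at once if the gap is 1 or 2, and otherwise
    [next] takes over. *)
Lemma squeeze g n a b d : walk g n -> a < b <= n ->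
  (forall y, a <= y <= b -> g y != d) ->
  (a.+2 < b -> forall d', step e d d' -> d' != g a.+1 -> d' != g b.-1 ->
     win (g a.+1) (g b.-1) d') ->
  win (g a) (g b) d.
Proof.
move=> gw ab gd next.
have sa : step e (g a) (g a.+1) by apply: gw; lia.
have sb : step e (g b) (g b.-1).
  by rewrite step_sym; have {2}-> : b = b.-1.+1; [lia | apply: gw; lia].
have [b1|b1|b1] := ltngtP a.+1 b; last 2 first.
- lia.
- by apply: (WinMeet (x := g b)); rewrite ?step_refl -?b1 // gd //; lia.
have [b2|b2|b2] := ltngtP a.+2 b; last 2 first.
- lia.
- apply: (WinMeet (x := g a.+1)); rewrite // ?gd //; last lia.
  by have -> : a.+1 = b.-1 by lia.
by apply: (WinMove (r' := g a.+1) (j' := g b.-1)); rewrite // ?gd //; try lia; apply: next.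
Qed.

(* [m] counts the moves made by Divider's agent since it stood on [g 0]. *)
Lemma race g n a b m d : walk g n ->
  (forall y q, y <= n -> reach q (g 0) (g y) -> minn y (n - y) <= q) ->
  m < a -> a < b -> b + m < n -> reach m (g 0) d -> win (g a) (g b) d.
Proof.
move=> gw giso; have [k] := ubnP (b - a).
elim: k a b m d => [|k IH] a b m d; first lia.
move=> bak ma ab bm rd; apply: (squeeze gw); first lia.
  move=> y yab; apply/eqP => gy; have := giso y m.
  by rewrite gy => /(_ _ rd); lia.
(* The bounds [m < a] and [b + m < n] survive the round because both ends of the arc move inwards as
   [m] grows. *)
move=> ab2 d' dd' _ _; apply: (IH _ _ m.+1); try lia.
by rewrite -addn1; apply: reach_cat rd _; rewrite reach1.
Qed.

Definition isometric c n := forall i j q, i <= j <= n ->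
  reach q (c i) (c j) -> minn (j - i) (n - (j - i)) <= q.

Lemma win_isometric c n a b d : cycle_of c n -> isometric c n ->
  a < b <= n -> b - a < n -> d != c a -> d != c b -> win (c a) (c b) d.
Proof.
move=> cP ciso; have [k] := ubnP (b - a).
elim: k a b d => [|k IH] a b d; first lia.
move=> bak abn ban da db.
have [cn cw ci] := cP.
have [/existsP[y /andP[ya /eqP cy]]|free] :=
    boolP [exists y : 'I_n.+1, (a < y < b) && (c y == d)]; last first.
  apply: (squeeze cw) => // [y yab|ab2 d' _ d'a d'b]; last by apply: IH => //; lia.
  have [->|ya] := eqVneq y a; first by rewrite eq_sym.
  have [->|yb] := eqVneq y b; first by rewrite eq_sym.
  apply: contraNneq free => cy; have yn : y < n.+1 by lia.
  by apply/existsP; exists (Ordinal yn); rewrite /= cy eqxx andbT; lia.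
move: (nat_of_ord y) cy ya => {}y cy ya.
(* [g] runs backwards round the cycle from the agent's vertex [c y]; on it, the segment between R
   and J is the complementary arc. *)
pose g i := if i <= y then c (y - i) else c (n + y - i).
have gw : walk g n.
  move=> i i_n; rewrite /g step_sym; case: ifP => lt1; case: ifP => lt2; try lia.
  - have -> : y - i = (y - i.+1).+1 by lia.
    by apply: cw; lia.
  - have -> : y - i = 0 by lia.
    rewrite -cn.
    have {2}-> : n = (n + y - i.+1).+1 by lia.
    by apply: cw; lia.
  - have -> : n + y - i = (n + y - i.+1).+1 by lia.
    by apply: cw; lia.
have -> : c a = g (y - a) by rewrite /g ifT; [congr c; lia | lia].
have -> : c b = g (n + y - b).
  rewrite /g; case: ifP => yb; last by congr c; lia.
  have -> : b = n by lia.
  by rewrite cn; congr c; lia.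
have g0 : g 0 = c y by rewrite /g subn0.
apply: (@race g n _ _ 0) => //; try lia; last by rewrite g0 /= cy.
move=> z q zn; rewrite g0 /g; case: ifP => zy.
  by rewrite reach_sym => /ciso; lia.
by move/ciso; lia.
Qed.

(** * Shortest shortcuts of a cycle *)

Definition shortcut (c : nat -> T) n q := [exists i : 'I_n, [exists j : 'I_n,
  [&& i < j, q < j - i, q < n - (j - i) & reach q (c i) (c j)]]].

(** Index [n] names the vertex of index 0, so a pair [(i, n)] is recorded as [(0, i)], with the two
    arc lengths exchanged. *)
Lemma shortcutI c n q i j : c n = c 0 -> i <= j <= n ->
  q < j - i -> q < n - (j - i) -> reach q (c i) (c j) -> shortcut c n q.
Proof.
move=> cn ijn qij qn r.
have [jn|jn] := ltnP j n.
  have i_n : i < n by lia.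
  apply/existsP; exists (Ordinal i_n); apply/existsP; exists (Ordinal jn).
  by rewrite /= r qij qn !andbT; lia.
have jE : j = n by lia.
have n0 : 0 < n by lia.
have i_n : i < n by lia.
apply/existsP; exists (Ordinal n0); apply/existsP; exists (Ordinal i_n).
have r0 : reach q (c 0) (c i) by rewrite -cn -jE reach_sym.
by rewrite /= r0 andbT; lia.
Qed.

Lemma isometricPn c n : cycle_of c n -> isometric c n \/ exists q, shortcut c n q.
Proof.
move=> [cn _ _].
have [/existsP[q sq]|nsc] := boolP [exists q : 'I_n, shortcut c n q].
  by right; exists q.
left=> i j q ijn r; rewrite leqNgt; apply: contra nsc => qlt.
have qn : q < n by lia.
by apply/existsP; exists (Ordinal qn) => /=; apply: (shortcutI cn ijn) r; lia.
Qed.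

(** A repeated vertex could be cut out. An inner vertex on the cycle would split [f] into two parts
    that are no shortcuts, and the triangle inequality along the cycle would make [q] too large. *)
Lemma min_shortcut c n q : cycle_of c n -> shortcut c n q ->
  (forall p, shortcut c n p -> q <= p) ->
  exists i j f, [/\ i < j < n, q < j - i, q < n - (j - i),
    [/\ f 0 = c i, f q = c j, walk f q & inj_upto f q.+1] &
    forall t l, 0 < t < q -> l <= n -> f t <> c l].
Proof.
move=> [cn cw ci] /existsP[[i i_n] /existsP[[j jn] /= /and4P[ij qij qn r]]] qmin.
have [f [f0 fq fw]] := reachP _ _ _ r.
exists i, j, f; split=> //; first lia.
  split=> // u v uv vq fuv.
  have r1 : reach (u + (q - v)) (c i) (c j).
    rewrite -f0 -fq; apply: (@reach_cat _ _ _ (f u)).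
      by rewrite -{1}(subn0 u); apply: (walk_reach fw); lia.
    by rewrite fuv; apply: (walk_reach fw); lia.
  have /qmin : shortcut c n (u + (q - v)) by apply: (shortcutI cn _ _ _ r1); lia.
  lia.
move=> t l tq ln ft.
have r1 : reach t (c i) (c l).
  by rewrite -f0 -ft -{1}(subn0 t); apply: (walk_reach fw); lia.
have r2 : reach (q - t) (c l) (c j).
  by rewrite -fq -ft; apply: (walk_reach fw); lia.
(* A connection shorter than [q] is no shortcut, so it is at least as long as one of the two arcs
   between its ends. *)
have sc p u v : u <= n -> v <= n -> p < q -> reach p (c u) (c v) ->
    maxn u v - minn u v <= p \/ n - (maxn u v - minn u v) <= p.
  move=> un vn pq ruv; case: (leqP (maxn u v - minn u v) p); first by left.
  case: (leqP (n - (maxn u v - minn u v)) p); first by right.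
  move=> p1 p2; suff /qmin : shortcut c n p by lia.
  have [uv|vu] := leqP u v; first by apply: (shortcutI cn _ _ _ ruv); lia.
  by rewrite reach_sym in ruv; apply: (shortcutI cn _ _ _ ruv); lia.
have := sc _ _ _ (ltnW i_n) ln _ r1; have := sc _ _ _ ln (ltnW jn) _ r2; lia.
Qed.

(** * Meeting on a cycle with a shortcut *)

Section ShorterCycles.
Variable n : nat.
Hypothesis IH : forall m, m < n -> forall c a b d, cycle_of c m ->
  a <= m -> b <= m -> c a != c b -> d != c a -> d != c b -> win (c a) (c b) d.

(** [q < k] makes the cycle through [f] shorter than [n], and both agents lie on the arc that it
    keeps. *)
Lemma win_same_side c k f q a b d : cycle_of c n -> 0 < k < n -> q < k ->
  f 0 = c 0 -> f q = c k -> walk f q -> inj_upto f q.+1 ->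
  (forall t i, 0 < t < q -> i <= n -> f t <> c i) ->
  k <= a <= n -> k <= b <= n -> c a != c b -> d != c a -> d != c b ->
  win (c a) (c b) d.
Proof.
move=> cP /andP[k0 kn] qk f0 fq fw fi fc ka kb ab da db.
have [c' [c'P _ c'r]] := splice cP kn k0 f0 fq fw fi fc.
rewrite -(c'r a) // -(c'r b) //.
by apply: (IH _ c'P); rewrite ?c'r //; lia.
Qed.

(** Reversing the cycle carries the arc [[0, k]] to [[n - k, n]]. *)
Lemma win_same_side' c k f q a b d : cycle_of c n -> 0 < k < n -> q < n - k ->
  f 0 = c 0 -> f q = c k -> walk f q -> inj_upto f q.+1 ->
  (forall t i, 0 < t < q -> i <= n -> f t <> c i) ->
  a <= k -> b <= k -> c a != c b -> d != c a -> d != c b ->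
  win (c a) (c b) d.
Proof.
move=> cP kn qk f0 fq fw fi fc ka kb ab da db.
have cn : c n = c 0 by case: cP.
have Ea : c a = c (n - (n - a)) by congr c; lia.
have Eb : c b = c (n - (n - b)) by congr c; lia.
rewrite Ea Eb.
apply: (@win_same_side (fun i => c (n - i)) (n - k) f q); rewrite -?Ea -?Eb //; try lia.
- exact: cycle_rev.
- by rewrite subn0 cn.
- by rewrite subKn //; lia.
by move=> t i tq _; apply: fc => //; lia.
Qed.

(* Divider's agent blocks at most one of the two runners, so the sum [a + b] of their
   indices decreases at each move. *)
Lemma win_opposite_sides c k f q a b d : cycle_of c n -> 0 < k < n ->
  q < k -> q < n - k ->
  f 0 = c 0 -> f q = c k -> walk f q -> inj_upto f q.+1 ->
  (forall t i, 0 < t < q -> i <= n -> f t <> c i) ->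
  a < k -> k <= b < n -> d != c a -> d != c b -> win (c a) (c b) d.
Proof.
move=> cP kn qk qk' f0 fq fw fi fc.
have [_ cw ci] := cP.
have [N] := ubnP (a + b); elim: N a b d => [|N IHN] a b d; first lia.
move=> abN ak kb da db.
have ab : c a != c b by apply/eqP/ci; lia.
(* At index 0, R is given index [n] and so shares the arc [[k, n]] with J. *)
have [a0|a0] := posnP a.
  have cn : c n = c 0 by case: cP.
  rewrite a0 -cn in ab da *.
  by apply: (win_same_side cP kn qk f0 fq fw fi fc) => //; lia.
have [bk|bk] := leqP b k.
  by apply: (win_same_side' cP kn qk' f0 fq fw fi fc) => //; lia.
have sa : step e (c a) (c a.-1).
  by rewrite step_sym; have {2}-> : a = a.-1.+1; [lia | apply: cw; lia].
have sb : step e (c b) (c b.-1).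
  by rewrite step_sym; have {2}-> : b = b.-1.+1; [lia | apply: cw; lia].
have ab1 : c a.-1 <> c b.-1 by apply: ci; lia.
(* A runner waits when Divider's agent stands on its next vertex; [ab1] prevents both from
   waiting. *)
pose a' := if c a.-1 == d then a else a.-1.
pose b' := if c b.-1 == d then b else b.-1.
have lt' : a' + b' < a + b.
  rewrite /a' /b'; case: eqP => [ad|_]; case: eqP => [bd|_]; try lia.
  by case: ab1; rewrite ad bd.
apply: (WinMove (r' := c a') (j' := c b')).
- by rewrite /a'; case: ifP; rewrite ?step_refl.
- by rewrite /b'; case: ifP; rewrite ?step_refl.
- by rewrite /a'; case: ifP => [_|/negbT//]; rewrite eq_sym.
- by rewrite /b'; case: ifP => [_|/negbT//]; rewrite eq_sym.
move=> d' _ d'a d'b; apply: IHN => //; try lia.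
  by rewrite /a'; case: ifP; lia.
by rewrite /b'; case: ifP; lia.
Qed.

Lemma win_shortcut c k f q a b d : cycle_of c n -> 0 < k < n ->
  q < k -> q < n - k ->
  f 0 = c 0 -> f q = c k -> walk f q -> inj_upto f q.+1 ->
  (forall t i, 0 < t < q -> i <= n -> f t <> c i) ->
  a <= n -> b <= n -> c a != c b -> d != c a -> d != c b -> win (c a) (c b) d.
Proof.
(* Reversing the cycle swaps the order of the two indices; [f] is still a chord, now between indices
   0 and [n - k]. *)
wlog ab : c k a b / a <= b => [W|].
  have [|/ltnW ba] := leqP a b; first exact: W.
  move=> cP kn qk qk' f0 fq fw fi fc an bn ab da db.
  have cn : c n = c 0 by case: cP.
  have Ea : c a = c (n - (n - a)) by congr c; lia.
  have Eb : c b = c (n - (n - b)) by congr c; lia.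
  rewrite Ea Eb; apply: (W (fun i => c (n - i)) (n - k)); rewrite -?Ea -?Eb //; try lia.
  - exact: cycle_rev.
  - by rewrite subn0 cn.
  - by rewrite subKn //; lia.
  - by move=> t i tq _; apply: fc => //; lia.
move=> cP kn qk qk' f0 fq fw fi fc an bn cab da db.
have cn : c n = c 0 by case: cP.
have [ka|ak] := leqP k a.
  by apply: (win_same_side cP kn qk f0 fq fw fi fc) => //; lia.
have [bk|kb] := leqP b k.
  by apply: (win_same_side' cP kn qk' f0 fq fw fi fc) => //; lia.
have [b_n|nb] := ltnP b n.
  by apply: (win_opposite_sides cP kn qk qk' f0 fq fw fi fc) => //; lia.
(* J stands on [c n = c 0], hence on the arc [[0, k]] together with R. *)
have bE : b = n by lia.
rewrite bE cn in cab db *.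
by apply: (win_same_side' cP kn qk' f0 fq fw fi fc) => //; lia.
Qed.

End ShorterCycles.

(** * Induction on the cycle length *)

Lemma win_cycle n c a b d : cycle_of c n -> a <= n -> b <= n ->
  c a != c b -> d != c a -> d != c b -> win (c a) (c b) d.
Proof.
elim/ltn_ind: n c a b d => n IH c a b d cP an bn ab da db.
have [cn cw ci] := cP.
have [ciso|exq] := isometricPn cP.
  wlog lt_ab : c a b cP {cn cw ci} ciso an bn ab da db / a < b => [W|].
    have [|lt_ba|E] := ltngtP a b; first exact: W; last by rewrite E eqxx in ab.
    have Ea : c a = c (n - (n - a)) by congr c; lia.
    have Eb : c b = c (n - (n - b)) by congr c; lia.
    rewrite Ea Eb; apply: (W (fun i => c (n - i))); rewrite -?Ea -?Eb //; try lia.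
      exact: cycle_rev.
    by move=> i j q ijn; rewrite reach_sym => /ciso; lia.
  have [cn _ _] := cP.
  apply: (win_isometric cP) => //; first by rewrite lt_ab.
  (* [c a != c b] excludes [a = 0] with [b = n]. *)
  rewrite ltnNge; move: ab; apply: contraNN => nab.
  have [-> ->] : b = n /\ a = 0 by lia.
  by rewrite cn.
case: (ex_minnP exq) => q sq qmin.
have [i [j [f [ijn qij qn [f0 fq fw fi] fc]]]] := min_shortcut cP sq qmin.
have i_n : i < n by lia.
(* A rotation puts the start of the shortest shortcut at index 0. *)
have [a' a'n Ea] := cycle_rot_index i_n cP an.
have [b' b'n Eb] := cycle_rot_index i_n cP bn.
have cP' := cycle_rot i_n cP.
set c' := (fun _ => _) in cP'.
have {}Ea : c' a' = c a by [].
have {}Eb : c' b' = c b by [].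
have f0' : f 0 = c' 0 by rewrite /c' add0n i_n.
have fq' : f q = c' (j - i) by rewrite /c' subnK ?ifT //; lia.
have fc' t l : 0 < t < q -> l <= n -> f t <> c' l.
  by move=> tq ln; rewrite /c'; case: ifP => li; apply: fc => //; lia.
have kn : 0 < j - i < n by lia.
rewrite -Ea -Eb in ab da db *.
by apply: (win_shortcut IH cP' kn qij qn f0' fq' fw fi fc').
Qed.

End Rendezvous.

(** * Cut vertices and the dividing number *)

Theorem theorem2 (T : finType) (e : rel T) (s t : T) :
  simple_graph e -> connected_graph e ->
  (dividing_number_is e s t 1 <-> cut_number_is e s t 1).
Proof.
move=> [e_sym _] e_conn; split.
  move=> [st est _ div1 _]; split=> //; last first.
    (* Connectedness keeps the empty set from separating. *)
    move=> S; rewrite ltnS leqn0 cards_eq0 => /eqP->.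
    rewrite /separates !inE /= negbK.
    rewrite (_ : connect _ s t = connect e s t) //.
    by apply: eq_connect => x y /=; rewrite !inE !andbT.
  have [/existsP[v sep]|nosep] := boolP [exists v, separates e [set v] s t].
    by exists [set v]; rewrite cards1.
  case: (win_not_divider_wins _ div1) => d ds dt.
  have [v vs vt|c [n [a [b [cP an bn ca cb]]]]] :=
    cycle_through e_sym st (e_conn s t).
    apply: contraNT nosep => nconn; apply/existsP; exists v.
    by rewrite /separates !inE eq_sym vs eq_sym vt.
  by rewrite -ca -cb; apply: (win_cycle e_sym cP); rewrite ?ca ?cb.
move=> [st est [S [/eqP/cards1P[v ->{S}] sep]] _].
move: sep; rewrite /separates !inE => /and3P[sv tv nconn].
split=> // [|k' /andP[k0 k1]]; last lia.
split=> //; exists [ffun=> v], (fun=> [ffun=> v]); split.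
  by move=> i; rewrite ffunE eq_sym sv eq_sym tv.
move=> f f0 n fP.
have dv m : dpos [ffun=> v] (fun=> [ffun=> v]) f m = [ffun=> v] :> dconf T 1.
  by case: m.
have stepP x y : x != v -> y != v -> step e x y -> connect (avoid e v) x y.
  move=> xv yv /orP[/eqP->//|xy]; apply: connect1.
  by rewrite /avoid /= xy !inE xv.
(* Neither R nor J can enter [v], so each stays in its own component of the graph without [v]. *)
have inv m : m <= n.+1 -> [/\ (f m).1 != v, (f m).2 != v,
    connect (avoid e v) s (f m).1 & connect (avoid e v) t (f m).2].
  elim: m => [_|m IH mn]; first by rewrite f0.
  have [v1 v2 c1 c2] := IH (ltnW mn).
  have := fP m mn; rewrite /fmove dv !occupied1 !ffunE => /and4P[s1 s2 w1 w2].
  rewrite eq_sym in w1; rewrite eq_sym in w2; split=> //.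
    exact: connect_trans c1 (stepP _ _ v1 w1 s1).
  exact: connect_trans c2 (stepP _ _ v2 w2 s2).
have [v1 v2 c1 c2] := inv n.+1 (leqnn _); split.
  apply: contraNneq nconn => f12; apply: connect_trans c1 _.
  by rewrite (avoid_connect_sym e_sym) f12.
apply/forallP => i; rewrite !dv !ffunE /step eqxx /=.
by rewrite eq_sym v1 eq_sym v2.
Qed.
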